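(* Let $\mu\in(0,1)$, let $R$ be a Bessel process of dimension $2(1-\mu)$ started from $0$, with local time $(L_t)$ at $0$. Let $n_\mu$ be the Lévy measure of the inverse local time of $R$ (equivalently, the distribution of the lifetime of excursions of $R$ away from $0$ under the Itô measure). Then $$n_\mu(dx)=\frac{1}{2^{\mu}\Gamma(\mu)}\,\frac{dx}{x^{1+\mu}},\qquad x>0.$$
   Context: $(\mathcal{F}_t)$ is the filtration generated by $(R_t)$ (with the usual augmentation). The point $0$ is instantaneously reflecting for $R$. The local time $(L_t)$ is normalized as the unique continuous adapted increasing process, null at $0$, such that $R_t^{2\mu}-L_t$ is an $(\mathcal{F}_t)$-martingale. The inverse local time is $\tau_u=\inf\{t\ge0: L_t>u\}$, a subordinator, and its Lévy measure $n_\mu$ is determined by $\mathbb{E}[e^{-\lambda\tau_u}]=\exp\left(-u\int_0^\infty(1-e^{-\lambda x})\,n_\mu(dx)\right)$, $\lambda\ge 0$. *)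

(* Defs.v *)
From HB Require Import structures.
From mathcomp Require Import all_boot all_order all_algebra.
From mathcomp Require Import all_classical all_reals all_analysis.

Set Implicit Arguments.
Unset Strict Implicit.
Unset Printing Implicit Defensive.

Import Order.TTheory GRing.Theory Num.Theory.
Import numFieldNormedType.Exports.

Local Open Scope classical_set_scope.
Local Open Scope ring_scope.

Section special_functions.
Context {R : realType}.

(* Euler's integral; it is used only for a > 0, where it converges. *)
Definition Gamma (a : R) : R :=
  \int[lebesgue_measure]_(x in `]0, +oo[) (x `^ (a - 1) * expR (- x)).

(* Modified Bessel function of the first kind
     I_nu(z) = \sum_k (z/2)^(2k + nu) / (k! Gamma(k + nu + 1)),
   for nu > -1 and z > 0. *)
Definition bessel_I (nu z : R) : R :=
  limn (series (fun k : nat =>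
    (z / 2) `^ (k%:R *+ 2 + nu) / (k`!%:R * Gamma (k%:R + nu + 1)))).

(* Transition density at time t > 0 on y > 0, with respect to dy, of the Bessel
   process of dimension delta > 0 started from x >= 0.  For 0 < delta < 2 this
   is the semigroup for which 0 is instantaneously reflecting: it involves
   I_nu with nu = delta / 2 - 1 < 0, whereas the process killed at 0 involves
   I_(- nu). *)
Definition bessel_density (delta t x y : R) : R :=
  let nu := delta / 2 - 1 in
  if x == 0 then
    2 `^ (- nu) * t `^ (- (nu + 1)) / Gamma (nu + 1) *
      y `^ (nu *+ 2 + 1) * expR (- (y ^+ 2) / (2 * t))
  else
    y / t * (y / x) `^ nu * expR (- (x ^+ 2 + y ^+ 2) / (2 * t)) *
      bessel_I nu (x * y / t).

Definition bessel_kernel (delta t x : R) (B : set R) : \bar R :=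
  (\int[lebesgue_measure]_(y in B `&` `]0%R, +oo[)
     (bessel_density delta t x y)%:E)%E.

End special_functions.

(* Processes are indexed by the reals, and only times t >= 0 are meaningful. *)
Section processes.
Context {d : measure_display} {T : measurableType d} {R : realType}.
Implicit Types (F : R -> set (set T)) (X : R -> T -> R).

Definition natural_filtration X (t : R) : set (set T) :=
  <<s \bigcup_(r in `[0, t]) preimage_set_system setT (X r) measurable >>.

(* Usual augmentation: the P-null events are added and the result is made
   right-continuous.  P need not be complete; if it is, the P-null events are
   all the P-negligible sets. *)
Definition usual_augmentation (P : probability T R) F (t : R) : set (set T) :=
  \bigcap_(s in `]t, +oo[)
    <<s F s `|` [set N | measurable N /\ P N = 0%E] >>.

Definition adapted F X : Prop :=
  forall t, 0 <= t -> preimage_set_system setT (X t) measurable `<=` F t.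

Definition continuous_paths X : Prop :=
  forall w, {within `[0, +oo[, continuous (X ^~ w)}.

(* The last clause is the defining property of E[M_t | F_s] = M_s. *)
Definition martingale (P : probability T R) F X : Prop :=
  [/\ adapted F X,
      forall t, 0 <= t -> P.-integrable setT (EFin \o X t) &
      forall s t A, 0 <= s -> s <= t -> F s A ->
        (\int[P]_(w in A) (X t w)%:E = \int[P]_(w in A) (X s w)%:E)%E].

(* The Bessel process of dimension delta > 0 started from 0, as the continuous
   Markov process on [0, +oo[ with the Bessel transition semigroup. *)
Definition bessel_process_from0 (P : probability T R) (delta : R) X : Prop :=
  [/\ continuous_paths X,
      forall t w, 0 <= t -> 0 <= X t w,
      forall w, X 0 w = 0 &
      forall s h A B, 0 <= s -> 0 < h ->
        natural_filtration X s A -> measurable B ->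
        P (A `&` X (s + h) @^-1` B) =
          (\int[P]_(w in A) bessel_kernel delta h (X s w) B)%E].

(* Local time at 0 of the Bessel process X of dimension 2 (1 - mu), normalized
   so that X^(2 mu) - L is a martingale. *)
Definition bessel_local_time (P : probability T R) (mu : R) X
    (L : R -> T -> R) : Prop :=
  let F := usual_augmentation P (natural_filtration X) in
  [/\ continuous_paths L,
      adapted F L,
      forall s t w, 0 <= s -> s <= t -> L s w <= L t w,
      forall w, L 0 w = 0 &
      martingale P F (fun t w => X t w `^ (2 * mu) - L t w)].

(* Equal to +oo if L never exceeds u. *)
Definition inverse_local_time (L : R -> T -> R) (u : R) (w : T) : \bar R :=
  ereal_inf [set t%:E | t in [set t | 0 <= t /\ u < L t w]].

(* n is the Levy measure of the (driftless) subordinator tau.  Measures on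
   ]0, +oo[ are encoded as Borel measures on the line that do not charge
   ]-oo, 0]. *)
Definition levy_measure_of (P : probability T R) (tau : R -> T -> \bar R)
    (n : {measure set (measurableTypeR R) -> \bar R}) : Prop :=
  [/\ n `]-oo, 0]%classic = 0%E,
      (\int[n]_(x in `]0%R, +oo[) (Num.min 1 x)%:E < +oo)%E &
      forall u lambda : R, 0 <= u -> 0 <= lambda ->
        (\int[P]_w expeR (- (lambda%:E * tau u w)) =
         expeR (- (u%:E * \int[n]_(x in `]0%R, +oo[)
                            (1 - expR (- (lambda * x)))%R%:E)))%E].

End processes.

(* Main.v *)
Require Import Defs.
From HB Require Import structures.
From mathcomp Require Import all_boot all_order all_algebra.
From mathcomp Require Import all_classical all_reals all_analysis.
From mathcomp Require Import measurable_realfun lra ring zify.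
Import Order.TTheory GRing.Theory Num.Theory.
Import numFieldNormedType.Exports.

Set Implicit Arguments.
Unset Strict Implicit.
Unset Printing Implicit Defensive.

Local Open Scope classical_set_scope.
Local Open Scope ring_scope.

(** Write Phi(c) for the integral of 1 - e^(-c x) against n(dx), so that
    E e^(-c tau_u) = e^(-u Phi(c)).  The theorem follows from a computation of
    Phi and from the fact that Phi determines n on ]0, +oo[.

    Computation of Phi.  Integrating over u > 0 gives
      1 / Phi(c) = int_(u > 0) E e^(-c tau_u) du.
    For u > 0 the set of the t > 0 with L_t > u is the half-line ]tau_u, +oo[,
    whence e^(-c tau_u) is the integral of c e^(-c t) over it
    ([integral_exp_after_inverse]).  Exchanging the three integrations turns
    the right-hand side into the Laplace transform
      int_(t > 0) c e^(-c t) E L_t dt     ([laplace_inverse_local_time]).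
    The martingale property at the times 0 and t gives E L_t = E R_t^(2 mu),
    and the density of R_t started from 0, times y^(2 mu), is a constant times
    y e^(-y^2 / 2t); hence E L_t = 2^mu t^mu / Gamma(1 - mu)
    ([expectation_local_time]).  The outcome is
      Phi(c) = Gamma(1 - mu) c^mu / (2^mu mu Gamma(mu)),
    which is also the exponent of the stated density
    ([integral_one_sub_exp_powR]).

    Uniqueness ([laplace_exponent_unique]).  Phi(c + 1) - Phi(c) is the Laplace
    transform of the finite measure (1 - e^(-x)) n(dx).  Hence Phi determines
    the integral against this measure of every polynomial in e^(-k x), in
    particular of (1 - e^(-k x))^N; with N of order k e^(k a) and k -> oo, these
    powers converge boundedly to the indicator of ]a, +oo[. *)

(** * Tonelli on rectangles and measures with a density *)

Lemma tonelli_rectangle (d1 d2 : measure_display) (T1 : measurableType d1)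
    (T2 : measurableType d2) (R : realType)
    (m1 : {sigma_finite_measure set T1 -> \bar R})
    (m2 : {sigma_finite_measure set T2 -> \bar R})
    (A : set T1) (B : set T2) (f : T1 * T2 -> \bar R) :
  measurable A -> measurable B -> measurable_fun (A `*` B) f ->
  (forall z, (A `*` B) z -> 0 <= f z)%E ->
  (\int[m1]_(x in A) \int[m2]_(y in B) f (x, y) =
   \int[m2]_(y in B) \int[m1]_(x in A) f (x, y))%E.
Proof.
move=> mA mB mf f0; pose g := f \_ (A `*` B).
have mg : measurable_fun setT g.
  exact: (proj1 (measurable_restrictT f (measurableX mA mB))).
have g0 z : (0 <= g z)%E by exact: (erestrict_ge0 f0).
transitivity (\int[m1]_x \int[m2]_y g (x, y))%E.
  rewrite integral_mkcond; apply: eq_integral => x _; rewrite patchE.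
  case: ifPn => [xA|xA].
    rewrite integral_mkcond; apply: eq_integral => y _.
    by rewrite /g !patchE in_setX xA.
  by rewrite integral0_eq// => y _; rewrite /g patchE in_setX (negbTE xA).
rewrite fubini_tonelli//.
rewrite [RHS]integral_mkcond; apply: eq_integral => y _; rewrite patchE.
case: ifPn => [yB|yB].
  rewrite [RHS]integral_mkcond; apply: eq_integral => x _.
  by rewrite /g !patchE in_setX yB andbT.
by rewrite integral0_eq// => x _; rewrite /g patchE in_setX (negbTE yB) andbF.
Qed.

(** The measure g dm.  The proofs [mg] and [g0] are arguments so that the
    measure structure below is found by unification. *)
Definition density_measure {d : measure_display} {T : measurableType d}
    {R : realType} (m : {measure set T -> \bar R}) (g : T -> R)
    (mg : measurable_fun setT g) (g0 : forall x, 0 <= g x) (A : set T) : \bar R :=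
  (\int[m]_(x in A) (g x)%:E)%E.

Section density_measure.
Context (d : measure_display) (T : measurableType d) (R : realType).
Variables (m : {measure set T -> \bar R}) (g : T -> R).
Hypotheses (mg : measurable_fun setT g) (g0 : forall x, 0 <= g x).

Local Notation nu := (density_measure m mg g0).

Let nu0 : nu set0 = 0%E.
Proof. exact: integral_set0. Qed.

Let nu_ge0 A : (0 <= nu A)%E.
Proof. by apply: integral_ge0 => x _; rewrite lee_fin. Qed.

Let nu_sigma_additive : semi_sigma_additive nu.
Proof.
move=> F mF tF mUF; rewrite /density_measure ge0_integral_bigcup//.
- by apply: is_cvg_ereal_nneg_natsum_cond => n _ _; exact: nu_ge0.
- exact/measurable_EFinP/measurable_funTS.
- by move=> x _; rewrite lee_fin.
Qed.

HB.instance Definition _ := isMeasure.Build _ _ _ nu nu0 nu_ge0 nu_sigma_additive.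

End density_measure.

Section integral_density.
Import HBNNSimple.

(** Integration against nu = g dm, for a measure nu known only through its
    values: true for indicators by hypothesis, hence for simple functions and,
    by monotone convergence, for nonnegative measurable functions. *)
Lemma ge0_integral_density (d : measure_display) (T : measurableType d)
    (R : realType) (m nu : {measure set T -> \bar R}) (g : T -> R) (f : T -> \bar R) :
  measurable_fun setT g -> (forall x, 0 <= g x) ->
  (forall A, measurable A -> nu A = \int[m]_(x in A) (g x)%:E)%E ->
  measurable_fun setT f -> (forall x, 0 <= f x)%E ->
  (\int[nu]_x f x = \int[m]_x (f x * (g x)%:E))%E.
Proof.
move=> mg g0 nuE mf f0.
have mgE : measurable_fun setT (EFin \o g) by exact/measurable_EFinP.
pose h := nnsfun_approx measurableT mf.
have mh n : measurable_fun setT (EFin \o h n) by exact/measurable_EFinP.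
have hf x : ((h n x)%:E @[n --> \oo] --> f x)%E by exact: cvg_nnsfun_approx.
have hnd x : {homo (fun n => (h n x)%:E) : a b / (a <= b)%N >-> (a <= b)%E}.
  by move=> a b ab; rewrite lee_fin; exact/lefP/nd_nnsfun_approx.
have -> : (\int[nu]_x f x = lim (\int[nu]_x (h n x)%:E @[n --> \oo]))%E.
  rewrite -monotone_convergence//; last by move=> n x _; rewrite lee_fin.
  by apply: eq_integral => x _; apply/esym/cvg_lim.
have -> : (\int[m]_x (f x * (g x)%:E) =
    lim (\int[m]_x ((h n x)%:E * (g x)%:E) @[n --> \oo]))%E.
  rewrite -monotone_convergence//.
  - by apply: eq_integral => x _; apply/esym/cvg_lim => //; exact: cvgeZr.
  - by move=> n; apply: emeasurable_funM => //; exact: mh.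
  - by move=> n x _; apply: mule_ge0; rewrite lee_fin ?g0.
  - by move=> x _ a b ab; rewrite lee_wpmul2r ?lee_fin//; exact: hnd.
congr (lim (_ @ \oo)); apply/funext => n.
transitivity (\int[nu]_x
   (\sum_(y \in range (h n)) (y * \1_(h n @^-1` [set y]) x)%:E))%E.
  by apply: eq_integral => t _; rewrite /= fimfunE -fsumEFin.
have mi r : measurable_fun setT (fun x => (r * \1_(h n @^-1` [set r]) x)%:E).
  exact/measurable_EFinP/measurable_funM.
rewrite ge0_integral_fsum//; last by move=> y x _; exact: nnfun_muleindic_ge0.
transitivity (\int[m]_x (\sum_(y \in range (h n))
    (y * \1_(h n @^-1` [set y]) x)%:E * (g x)%:E))%E; last first.
  apply: eq_integral => x _.
  rewrite -ge0_mule_fsuml => [|y]; last exact: nnfun_muleindic_ge0.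
  by rewrite fsumEFin// -(fimfunE _ x).
rewrite ge0_integral_fsum//; last 2 first.
- by move=> y; exact: emeasurable_funM.
- by move=> y x _; apply: mule_ge0; rewrite ?lee_fin ?g0// -lee_fin EFinM nnfun_muleindic_ge0.
apply: eq_fsbigr => r; rewrite inE => -[t _ <-].
under eq_integral do rewrite EFinM.
rewrite integralZl_indic_nnsfun//.
under [RHS]eq_integral do rewrite EFinM -muleA.
rewrite ge0_integralZl//; last 3 first.
- by apply: emeasurable_funM => //; exact/measurable_EFinP.
- by move=> x _; apply: mule_ge0; rewrite lee_fin ?g0.
- by rewrite lee_fin.
congr (_ * _)%E; rewrite integral_indic// setIT nuE//.
rewrite integral_mkcond; apply: eq_integral => x _.
by rewrite epatch_indic muleC.
Qed.

End integral_density.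

(** * Elementary integrals *)

Section calculus.
Context {R : realType}.
Implicit Types (a b c s x : R).
Local Notation leb := (@lebesgue_measure R).

Lemma is_derive_expRM c x :
  is_derive x 1 (fun y : R => expR (c * y)) (c * expR (c * x)).
Proof.
have h : is_derive x 1 (fun y : R => c * y) c.
  apply: (@is_derive_eq R _ _ _ x 1 _ c); last by [].
  rewrite -[X in is_derive _ _ _ X]mulr1; exact: is_deriveZ.
have := @is_derive1_comp R expR ( *%R c) x _ _ (is_derive_expR _) h.
by rewrite mulrC.
Qed.

Lemma continuous_expRM c : continuous (fun y : R => expR (c * y)).
Proof.
move=> x; apply: differentiable_continuous; apply/derivable1_diffP.
by have [] := is_derive_expRM c x.
Qed.

Lemma is_derive_exp_primitive c x :
  is_derive x 1 (fun y : R => - expR (- c * y)) (c * expR (- (c * x))).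
Proof.
by have := is_deriveN (is_derive_expRM (- c) x); rewrite !mulNr opprK.
Qed.

Lemma continuous_exp_density c : continuous (fun y : R => c * expR (- (c * y))).
Proof.
move=> x; apply: cvgM; first exact: cvg_cst.
under eq_fun do rewrite -mulNr.
by rewrite -mulNr; exact: continuous_expRM.
Qed.

Lemma integral_exp_tail c s : 0 < c ->
  (\int[leb]_(x in `]s, +oo[) (c * expR (- (c * x)))%:E =
   (expR (- (c * s)))%:E)%E.
Proof.
move=> c0.
have mf := continuous_measurable_fun (@continuous_exp_density c).
rewrite integral_itv_obnd_cbnd; last exact/measurable_EFinP/measurable_funTS.
rewrite (@ge0_continuous_FTC2y _ _ (fun x => - expR (- c * x)) _ 0).
- by rewrite sub0e -EFinN opprK mulNr.
- by move=> x _; rewrite mulr_ge0 ?expR_ge0 ?ltW.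
- exact/continuous_subspaceT/continuous_exp_density.
- rewrite -oppr0; apply: cvgN.
  have -> : (fun x => expR (- c * x)) = (fun z => expR (- z)) \o (fun z => c * z).
    by apply/funext => x /=; rewrite mulNr.
  apply: (@cvg_comp _ _ _ _ _ _ (pinfty_nbhs R)); last exact: cvgr_expR.
  exact: gt0_cvgMry.
- by move=> x _; have [] := is_derive_exp_primitive c x.
- by apply: cvg_at_right_filter; apply: cvgN; apply: continuous_expRM.
- by move=> x _; rewrite derive1E; have [_ ->] := is_derive_exp_primitive c x.
Qed.

Lemma integral_exp_segment c b : 0 < b ->
  (\int[leb]_(x in `]0%R, b[) (c * expR (- (c * x)))%:E =
   (1 - expR (- (c * b)))%:E)%E.
Proof.
move=> b0.
have mf := continuous_measurable_fun (@continuous_exp_density c).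
rewrite -(@integral_itv_bndoo _ _ _ _ true false); last exact/measurable_EFinP/measurable_funTS.
rewrite (@continuous_FTC2 _ _ (fun x => - expR (- c * x))) //.
- by rewrite mulr0 expR0 -EFinB opprK addrC mulNr.
- exact/continuous_subspaceT/continuous_exp_density.
- split.
  + by move=> x _; have [] := is_derive_exp_primitive c x.
  + by apply: cvg_at_right_filter; apply: cvgN; apply: continuous_expRM.
  + by apply: cvg_at_left_filter; apply: cvgN; apply: continuous_expRM.
- by move=> x _; rewrite derive1E; have [_ ->] := is_derive_exp_primitive c x.
Qed.

(** For a < 1 the integrand is singular at 0, so the fundamental theorem is
    applied on [b / (n + 2), b] and n tends to infinity. *)
Lemma integral_powR_segment a b : 0 < a -> 0 < b ->
  (\int[leb]_(x in `]0%R, b[) (x `^ (a - 1))%:E = (b `^ a / a)%:E)%E.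
Proof.
move=> a0 b0.
pose F (x : R) := a^-1 * x `^ a.
have dF x : 0 < x -> is_derive x 1 F (x `^ (a - 1)).
  move=> x0; apply: (@is_derive_eq _ _ _ _ _ _ _ (a^-1 *: (a * x `^ (a - 1)))).
    by apply: is_deriveZ; exact: is_derive1_powR.
  by rewrite /GRing.scale/= mulrA mulVf ?mul1r// gt_eqF.
have cF x p : 0 < x -> {for x, continuous (fun y => y `^ p : R)}.
  move=> x0; apply: differentiable_continuous; apply/derivable1_diffP.
  by have [] := is_derive1_powR p x0.
pose I n := [set` `[b / n.+2%:R, b] : interval R].
have mI n : measurable (I n) by exact: measurable_itv.
have intI n : (\int[leb]_(x in I n) (x `^ (a - 1))%:E =
    (F b - F (b / n.+2%:R))%:E)%E.
  have bn0 : 0 < b / n.+2%:R by rewrite divr_gt0.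
  have bnb : b / n.+2%:R < b by rewrite ltr_pdivrMr// ltr_pMr// ltr1n.
  rewrite EFinB; apply: continuous_FTC2 => //.
  - apply: derivable_within_continuous => x; rewrite in_itv/= => /andP[xb _].
    by have [] := is_derive1_powR (a - 1) (lt_le_trans bn0 xb).
  - split.
    + move=> x; rewrite in_itv/= => /andP[xb _].
      by have [] := dF _ (lt_trans bn0 xb).
    + by apply: cvg_at_right_filter; apply: cvgM; [exact: cvg_cst|exact: cF].
    + by apply: cvg_at_left_filter; apply: cvgM; [exact: cvg_cst|exact: cF].
  - move=> x; rewrite in_itv/= => /andP[xb _].
    by rewrite derive1E; have [_ ->] := dF _ (lt_trans bn0 xb).
have mp : measurable_fun setT (fun x : R => (x `^ (a - 1))%:E).
  by apply/measurable_EFinP; exact: (measurable_powR (a - 1)).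
rewrite -(@integral_itv_bndoo _ _ _ _ false false); last exact: measurable_funTS.
have UI : \bigcup_n I n = [set` `]0, b] : interval R].
  apply/seteqP; split=> [x [n _]|x]; rewrite /I /mkset !in_itv/=.
    by move=> /andP[h ->]; rewrite andbT; apply: lt_le_trans h; rewrite divr_gt0.
  move=> /andP[x0 xb]; exists (Num.truncn (b / x)) => //=.
  rewrite in_itv/= xb andbT ler_pdivrMr// mulrC -ler_pdivrMr//.
  by rewrite (le_trans (ltW (truncnS_gt _)))// ler_nat.
have cvgI : (\int[leb]_(x in I n) (x `^ (a - 1))%:E @[n --> \oo] -->
    \int[leb]_(x in [set` `]0%R, b] : interval R]) (x `^ (a - 1))%:E)%E.
  rewrite -UI; apply: ge0_nondecreasing_set_cvg_integral => //.
  - move=> m n mn; apply/subsetPset => x; rewrite /I /mkset !in_itv/=.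
    move=> /andP[h ->]; rewrite andbT; apply: le_trans h.
    by rewrite ler_pM2l// lef_pV2 ?posrE// ler_nat.
  - by move=> n; exact: measurable_funTS.
  - by move=> n x _; rewrite lee_fin powR_ge0.
move: cvgI; rewrite (_ : (fun n => _) = (fun n => (F b - F (b / n.+2%:R))%:E)); last first.
  by apply/funext => n; rewrite intI.
move=> cvgI; apply: (cvg_unique _ cvgI) => //.
apply: cvg_EFin; first exact: nearW.
rewrite -[X in _ --> X]subr0 /F mulrC; apply: cvgB; first exact: cvg_cst.
rewrite -[X in _ --> X](mulr0 a^-1); apply: cvgM; first exact: cvg_cst.
have /cvg_at_rightP := powR_cvg0 a0; apply; split=> [n|]; first by rewrite divr_gt0.
rewrite -[X in _ --> X](mulr0 b); apply: cvgM; first exact: cvg_cst.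
by have := @cvg_harmonic R; rewrite -cvg_shiftS.
Qed.

(** Lebesgue measure is c times its image under x |-> c x, since both agree on
    half-open intervals. *)
Lemma ge0_integral_scaling c (f : R -> \bar R) : 0 < c ->
  measurable_fun setT f -> (forall x, 0 <= f x)%E ->
  (\int[leb]_(x in `]0%R, +oo[) f x =
   c%:E * \int[leb]_(x in `]0%R, +oo[) f (c * x)%R)%E.
Proof.
move=> c0 mf f0.
pose phi : measurableTypeR R -> measurableTypeR R := *%R c.
have mphi : measurable_fun setT phi by exact: measurable_funM.
pose k : {nonneg R} := NngNum (ltW c0).
have [pm pmE] : exists pm : {measure set (measurableTypeR R) -> \bar R},
    pm = pushforward leb phi :> (_ -> _).
  by exists (measure_function_pushforward__canonical__measure_function_Measure leb mphi).
have lebE A : measurable A -> leb A = mscale k pm A.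
  apply: lebesgue_measure_unique => _ [[x y]] /= _ <-.
  rewrite /mscale/= pmE /pushforward.
  have -> : phi @^-1` [set` `]x, y]] = [set` `]x / c, y / c]].
    apply/seteqP; split=> z; rewrite /preimage /mkset /= !in_itv/= /phi;
    by rewrite ltr_pdivrMr// ler_pdivlMr// mulrC.
  rewrite !lebesgue_measure_itv/= !lte_fin ltr_pM2r ?invr_gt0//.
  case: ifPn => _; last by rewrite mule0.
  by rewrite -!EFinB -EFinM -mulrBl mulrC divfK// gt_eqF.
rewrite (eq_measure_integral (mscale k pm)); last by move=> A mA _; exact: lebE.
rewrite ge0_integral_mscale//; last exact: measurable_funTS.
congr (_ * _)%E.
transitivity (\int[pushforward leb phi]_(x in `]0%R, +oo[) f x)%E.
  by apply: eq_measure_integral => A _ _; rewrite pmE.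
rewrite ge0_integral_pushforward//; last exact: measurable_funTS.
rewrite (_ : phi @^-1` _ = `]0%R, +oo[%classic)//.
by apply/seteqP; split=> z; rewrite /preimage /mkset /= !in_itv/= !andbT pmulr_rgt0.
Qed.

End calculus.

(** * Euler's integral and the exponent of the stable density *)

Section gamma.
Context {R : realType}.
Implicit Types (a b c s x : R).
Local Notation leb := (@lebesgue_measure R).

(** Moves a condition on the variable from the integrand to the domain; it
    serves to exchange integrals over the triangle s < x. *)
Lemma integral_cutoff (D E : set R) (b : R -> bool) (g : R -> R) :
  (forall x, E x <-> D x /\ b x) ->
  (\int[leb]_(x in D) (g x * (b x)%:R)%:E = \int[leb]_(x in E) (g x)%:E)%E.
Proof.
move=> EDb; rewrite integral_mkcond [RHS]integral_mkcond.
apply: eq_integral => x _; rewrite !patchE.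
have -> : (x \in E) = (x \in D) && b x.
  by apply/idP/andP; rewrite !inE => /EDb.
by case: (x \in D) => //=; case: (b x); rewrite ?mulr1 ?mulr0.
Qed.

Lemma measurable_set_ltr (d : measure_display) (T : measurableType d)
    (f g : T -> R) : measurable_fun setT f -> measurable_fun setT g ->
  measurable [set z | (f z < g z)%R].
Proof.
move=> mf mg; have mlt := measurable_fun_ltr mf mg.
by rewrite -[X in measurable X]setTI; apply: (mlt measurableT [set true]).
Qed.

Lemma measurable_ltr_indicator (d : measure_display) (T : measurableType d)
    (f g : T -> R) : measurable_fun setT f -> measurable_fun setT g ->
  measurable_fun setT (fun z => (f z < g z)%R%:R : R).
Proof.
move=> mf mg.
have -> : (fun z => (f z < g z)%R%:R : R) = \1_[set z | (f z < g z)%R].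
  apply/funext => z; rewrite indicE.
  by have [h|/negP h] := boolP (f z < g z); [rewrite mem_set|rewrite memNset].
exact/measurable_indic/measurable_set_ltr.
Qed.

(** Euler's integral in the extended reals: Tonelli's theorem then applies with
    no convergence to check, and finiteness is settled once. *)
Definition gamma_integral a : \bar R :=
  (\int[leb]_(x in `]0%R, +oo[) (x `^ (a - 1) * expR (- x))%:E)%E.

Lemma measurable_powR_exp a c :
  measurable_fun setT (fun x : R => (x `^ (a - 1) * expR (- (c * x)))%:E).
Proof.
apply/measurable_EFinP; apply: measurable_funM; first exact: measurable_powR.
apply: measurableT_comp => //; apply: measurableT_comp => //.
Qed.

Lemma measurable_gamma_integrand a :
  measurable_fun setT (fun x : R => (x `^ (a - 1) * expR (- x))%:E).
Proof.
have := measurable_powR_exp a 1.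
by rewrite (_ : (fun x => _) = (fun x : R => (x `^ (a - 1) * expR (- x))%:E))//;
  apply/funext => x; rewrite mul1r.
Qed.

Lemma gamma_integral_ge0 a : (0 <= gamma_integral a)%E.
Proof.
by apply: integral_ge0 => x _; rewrite lee_fin mulr_ge0 ?powR_ge0 ?expR_ge0.
Qed.

Lemma integral_powR_exp a c : 0 < c ->
  (\int[leb]_(x in `]0%R, +oo[) (x `^ (a - 1) * expR (- (c * x)))%:E =
   (c `^ (- a))%:E * gamma_integral a)%E.
Proof.
move=> c0; rewrite /gamma_integral.
have m1 := measurable_gamma_integrand a.
rewrite [X in (_ * X)%E](@ge0_integral_scaling R c)//; last first.
  by move=> x; rewrite lee_fin mulr_ge0 ?powR_ge0 ?expR_ge0.
under [X in (_ * (_ * X))%E]eq_integral => x.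
  rewrite inE/= in_itv/= andbT => x0.
  rewrite powRM ?ltW// -mulrA EFinM.
  over.
rewrite ge0_integralZl_EFin//; last 3 first.
- by move=> x _; rewrite lee_fin mulr_ge0 ?powR_ge0 ?expR_ge0.
- by apply: measurable_funTS; apply: measurable_powR_exp.
- exact: powR_ge0.
rewrite !muleA -!EFinM -[X in _ * X * _](powRr1 (ltW c0)).
rewrite -!powRD ?(gt_eqF c0) ?implybT//.
by rewrite [X in _ `^ X](_ : _ = 0) ?powRr0 ?mul1e//; lra.
Qed.

(** On ]0, 1[ the integrand is at most x^(a - 1), on [1, +oo[ it is at most
    e^(-x) because a - 1 <= 0. *)
Lemma gamma_integral_lty a : 0 < a <= 1 -> (gamma_integral a < +oo)%E.
Proof.
move=> /andP[a0 a1]; rewrite /gamma_integral.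
have m1 := measurable_gamma_integrand a.
have f0 x : (0 <= (x `^ (a - 1) * expR (- x))%:E)%E.
  by rewrite lee_fin mulr_ge0 ?powR_ge0 ?expR_ge0.
have -> : `]0%R, +oo[%classic = `]0%R, 1%R[ `|` `[1%R, +oo[ :> set R.
  apply/seteqP; split=> x; rewrite /setU /mkset /= !in_itv/= !andbT.
    by move=> ->; case: (ltP x 1) => _; [left|right].
  by move=> [/andP[]//|]; apply: lt_le_trans.
rewrite ge0_integral_setU//; last 2 first.
- exact: measurable_funTS.
- apply/disj_setPS => x []; rewrite /mkset /= !in_itv/= andbT => /andP[_ x1].
  by rewrite leNgt x1.
apply: lte_add_pinfty.
- apply: (@le_lt_trans _ _ (\int[leb]_(x in `]0%R, 1%R[) (x `^ (a - 1))%:E)%E).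
    apply: ge0_le_integral => //.
    + exact: measurable_funTS.
    + by apply: measurable_funTS; apply/measurable_EFinP; exact: (measurable_powR (a - 1)).
    + move=> x; rewrite /mkset /= in_itv/= => /andP[x0 _].
      rewrite lee_fin ler_piMr ?powR_ge0// -expR0 ler_expR.
      by rewrite oppr_le0 ltW.
  by rewrite integral_powR_segment// ltry.
- apply: (@le_lt_trans _ _ (\int[leb]_(x in `[1%R, +oo[) (1 * expR (- (1 * x)))%:E)%E).
    apply: ge0_le_integral => //.
    + exact: measurable_funTS.
    + apply/measurable_funTS; apply/measurable_EFinP.
      exact: (continuous_measurable_fun (@continuous_exp_density _ 1)).
    + move=> x; rewrite /mkset /= in_itv/= andbT => x1.
      rewrite lee_fin !mul1r ler_piMl ?expR_ge0//.
      by rewrite -[leRHS](powRr0 x) ler_powR// subr_le0.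
  rewrite -integral_itv_obnd_cbnd; last first.
    apply/measurable_funTS; apply/measurable_EFinP.
    exact: (continuous_measurable_fun (@continuous_exp_density _ 1)).
  by rewrite integral_exp_tail// ltry.
Qed.

Lemma gamma_integral_gt0 a : 0 < a <= 1 -> (0 < gamma_integral a)%E.
Proof.
move=> /andP[a0 a1]; rewrite /gamma_integral.
have m1 := measurable_gamma_integrand a.
have f0 x : (0 <= (x `^ (a - 1) * expR (- x))%:E)%E.
  by rewrite lee_fin mulr_ge0 ?powR_ge0 ?expR_ge0.
apply: (@lt_le_trans _ _ (\int[leb]_(x in `]0%R, 1%R[) (x `^ (a - 1) * expR (- x))%:E)%E);
  last first.
  apply: ge0_subset_integral => //; first exact: measurable_funTS.
  by move=> x; rewrite /mkset /= !in_itv/= andbT => /andP[].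
apply: (@lt_le_trans _ _ (\int[leb]_(x in `]0%R, 1%R[) (expR (- 1))%:E)%E).
  rewrite integral_cst//= lebesgue_measure_itv/= lte_fin ltr01 sube0 mule1.
  by rewrite lte_fin expR_gt0.
apply: ge0_le_integral => //.
- exact: measurable_funTS.
- move=> x; rewrite /mkset /= in_itv/= => /andP[x0 x1].
  rewrite lee_fin -[leLHS]mul1r ler_pM ?expR_ge0//.
    by rewrite -[leLHS](powRr0 x) ger_powR ?x0 ?(ltW x1)// subr_le0.
  by rewrite ler_expR lerN2 ltW.
Qed.

(** The real number [Gamma a] is the value of an integral whose divergence would
    be read as 0; finiteness rules this out. *)
Lemma GammaE a : 0 < a <= 1 -> (Gamma a)%:E = gamma_integral a.
Proof.
move=> a01; rewrite /Gamma /Rintegral fineK// ge0_fin_numE.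
  exact: gamma_integral_lty.
exact: gamma_integral_ge0.
Qed.

Lemma Gamma_gt0 a : 0 < a <= 1 -> 0 < Gamma a.
Proof. by move=> a01; rewrite -lte_fin GammaE// gamma_integral_gt0. Qed.

(** Write x^a as the integral of a s^(a - 1) over 0 < s < x and integrate in x
    first; this replaces an integration by parts. *)
Lemma gamma_integral_succ a : 0 < a ->
  gamma_integral (a + 1) = (a%:E * gamma_integral a)%E.
Proof.
move=> a0; pose D := `]0%R, +oo[%classic : set R.
have mD : measurable D by exact: measurable_itv.
pose f (z : R * R) : \bar R :=
  (a * z.2 `^ (a - 1) * expR (- z.1) * (z.2 < z.1)%R%:R)%:E.
have mp : measurable_fun setT (fun x : R => (x `^ (a - 1))%:E).
  by apply/measurable_EFinP; exact: (measurable_powR (a - 1)).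
have mf : measurable_fun setT f.
  apply/measurable_EFinP; apply: measurable_funM; first apply: measurable_funM.
  - apply: measurable_funM => //.
    by apply: measurableT_comp (measurable_powR _) _; exact: measurable_snd.
  - by apply: measurableT_comp => //; apply: measurableT_comp => //.
  - exact: measurable_ltr_indicator.
have f0 z : (D `*` D) z -> (0 <= f z)%E.
  by move=> _; rewrite lee_fin !mulr_ge0 ?powR_ge0 ?expR_ge0 ?(ltW a0).
transitivity (\int[leb]_(x in D) \int[leb]_(s in D) f (x, s))%E.
  apply: eq_integral => x; rewrite inE /D /mkset /= in_itv/= andbT => x0.
  rewrite (@integral_cutoff _ `]0, x[%classic (fun s => s < x)
      (fun s => a * s `^ (a - 1) * expR (- x))); last first.
    by move=> s; rewrite /mkset /= !in_itv/= andbT; split=> /andP.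
  under eq_integral do rewrite -mulrA mulrCA EFinM.
  rewrite ge0_integralZr//; last 3 first.
  - exact: measurable_funTS.
  - by move=> s _; rewrite lee_fin powR_ge0.
  - by rewrite lee_fin mulr_ge0 ?expR_ge0 ?(ltW a0).
  rewrite integral_powR_segment// -EFinM addrK mulrA divfK ?gt_eqF//.
rewrite tonelli_rectangle//; last exact: measurable_funTS.
rewrite -ge0_integralZl_EFin//; last 3 first.
- by move=> s _; rewrite lee_fin mulr_ge0 ?powR_ge0 ?expR_ge0.
- by apply: measurable_funTS; exact: measurable_gamma_integrand.
- exact: ltW.
apply: eq_integral => s; rewrite inE /D /mkset /= in_itv/= andbT => s0.
rewrite (@integral_cutoff _ `]s, +oo[%classic (fun x => s < x)
    (fun x => a * s `^ (a - 1) * expR (- x))); last first.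
  move=> x; rewrite /mkset /= !in_itv/= !andbT; split=> [sx|[]//].
  by split=> //; exact: lt_trans sx.
transitivity (\int[leb]_(x in `]s, +oo[)
    ((a * s `^ (a - 1))%:E * (1 * expR (- (1 * x)))%:E))%E.
  by apply: eq_integral => x _; rewrite !mul1r EFinM.
rewrite ge0_integralZl_EFin//; last 2 first.
- apply: measurable_funTS; apply/measurable_EFinP.
  exact: (continuous_measurable_fun (@continuous_exp_density _ 1)).
- by rewrite mulr_ge0 ?powR_ge0 ?(ltW a0).
by rewrite integral_exp_tail// mul1r -!EFinM mulrA.
Qed.

(** Write 1 - e^(-lambda x) as the integral of x e^(-s x) over 0 < s < lambda
    and integrate in x first: the inner integral is Gamma(1 - mu) s^(mu - 1). *)
Lemma integral_one_sub_exp_powR (mu lambda : R) : 0 < mu < 1 -> 0 < lambda ->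
  (\int[leb]_(x in `]0%R, +oo[) ((1 - expR (- (lambda * x))) * (x `^ (1 + mu))^-1)%:E =
   (lambda `^ mu / mu * Gamma (1 - mu))%:E)%E.
Proof.
move=> /andP[mu0 mu1] l0; pose D := `]0%R, +oo[%classic : set R.
have mD : measurable D by exact: measurable_itv.
pose f (z : R * R) : \bar R :=
  (z.1 * expR (- (z.1 * z.2)) * (z.1 `^ (1 + mu))^-1)%:E.
have mf : measurable_fun setT f.
  apply/measurable_EFinP; apply: measurable_funM; first apply: measurable_funM.
  - exact: measurable_fst.
  - apply: measurableT_comp => //; apply: measurableT_comp => //.
    by apply: measurable_funM; [exact: measurable_fst|exact: measurable_snd].
  - under eq_fun do rewrite -powRN.
    by apply: measurableT_comp (measurable_powR _) _; exact: measurable_fst.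
have f0 z : (D `*` `]0%R, lambda[) z -> (0 <= f z)%E.
  move=> -[]; rewrite /D /mkset /= in_itv/= andbT => x0 _.
  by rewrite lee_fin !mulr_ge0 ?expR_ge0 ?invr_ge0 ?powR_ge0 ?(ltW x0).
transitivity (\int[leb]_(x in D) \int[leb]_(s in `]0%R, lambda[) f (x, s))%E.
  apply: eq_integral => x; rewrite inE /D /mkset /= in_itv/= andbT => x0.
  under eq_integral do rewrite /f /= EFinM.
  rewrite ge0_integralZr//; last 4 first.
  - exact: measurable_itv.
  - apply: measurable_funTS; apply/measurable_EFinP.
    exact: (continuous_measurable_fun (@continuous_exp_density _ x)).
  - by move=> s _; rewrite lee_fin mulr_ge0 ?expR_ge0 ?(ltW x0).
  - by rewrite lee_fin invr_ge0 powR_ge0.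
  by rewrite integral_exp_segment// -EFinM (mulrC lambda).
transitivity (\int[leb]_(s in `]0%R, lambda[) \int[leb]_(x in D) f (x, s))%E.
  by apply: tonelli_rectangle => //; exact: measurable_funTS.
transitivity (\int[leb]_(s in `]0%R, lambda[) ((s `^ (mu - 1))%:E * (Gamma (1 - mu))%:E))%E.
  apply: eq_integral => s; rewrite inE /mkset /= in_itv/= => /andP[s0 _].
  rewrite GammaE; last by rewrite subr_gt0 mu1 lerBlDr lerDl ltW.
  have -> : mu - 1 = - (1 - mu) by rewrite opprB.
  rewrite -integral_powR_exp//.
  apply: eq_integral => x; rewrite inE /D /mkset /= in_itv/= andbT => x0.
  congr EFin; rewrite mulrAC mulrC (mulrC x s) mulrC; congr (_ * _).
  rewrite -powRN -[X in X * _]powRr1 ?(ltW x0)// -powRD ?(gt_eqF x0) ?implybT//.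
  by congr (_ `^ _); lra.
rewrite ge0_integralZr//; last 3 first.
- by apply: measurable_funTS; apply/measurable_EFinP; exact: (measurable_powR (mu - 1)).
- by move=> s _; rewrite lee_fin powR_ge0.
- by rewrite lee_fin ltW// Gamma_gt0// subr_gt0 mu1 lerBlDr lerDl ltW.
by rewrite integral_powR_segment.
Qed.

End gamma.

(** * Powers that converge to the indicator of a half-line *)

Section cutoff_powers.
Context {R : realType}.
Implicit Types (a c x : R).

(** An integer between n e^(n a) and 2 n e^(n a) for a >= 0.  The
    additional factor n makes the limit 0 at the point x = a as well. *)
Definition cutoff_power a (n : nat) : nat := (n * (Num.truncn (expR (n%:R * a))).+1)%N.

(** e^(n c) = (e^(n c / 2))^2 >= (n c / 2)^2, so the sequence is O(1 / n). *)
Lemma cvg_natM_expR_opp c : 0 < c ->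
  n%:R * expR (- (n%:R * c)) @[n --> \oo] --> (0 : R).
Proof.
move=> c0; pose K := (2 / c) ^+ 2.
apply: (@squeeze_cvgr _ _ _ _ (cst 0) (fun n => K * harmonic n *+ 2)).
- near=> n; apply/andP; split; first by rewrite mulr_ge0 ?expR_ge0.
  have n0 : (0 < n)%N by near: n; exists 1%N.
  have nR : 0 < (n%:R : R) by rewrite ltr0n.
  have -> : - (n%:R * c) = - (n%:R * c / 2) - (n%:R * c / 2) by lra.
  rewrite expRD !expRN -expr2 exprVn.
  have h : (n%:R * c / 2) ^+ 2 <= expR (n%:R * c / 2) ^+ 2.
    rewrite lerXn2r ?nnegrE ?expR_ge0 ?divr_ge0 ?mulr_ge0 ?(ltW c0)//.
    by apply: le_trans (expR_ge1Dx _); rewrite lerDr.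
  have q0 : 0 < (n%:R * c / 2) ^+ 2 by rewrite exprn_gt0// divr_gt0// mulr_gt0.
  apply: (@le_trans _ _ (n%:R * ((n%:R * c / 2) ^+ 2)^-1)).
    by rewrite ler_pM2l// lef_pV2 ?posrE ?q0 ?exprn_gt0 ?expR_gt0//.
  have -> : n%:R * ((n%:R * c / 2) ^+ 2)^-1 = K * n%:R^-1.
    by rewrite /K; field; rewrite !gt_eqF.
  rewrite -mulrnAr ler_pM2l ?exprn_gt0 ?divr_gt0// /harmonic/=.
  rewrite -[leRHS]mulr_natr ler_pdivlMl ?ltr0n// ler_pdivrMr//.
  by rewrite -natrM ler_nat; lia.
- exact: cvg_cst.
- have := @cvg_harmonic R => h.
  rewrite -[X in _ --> X](mul0rn _ 2) -[X in X *+ 2](mulr0 K).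
  by apply: cvgMn; apply: cvgM => //; exact: cvg_cst.
Unshelve. all: by end_near. Qed.

(** Let y = e^(-n x) and N = cutoff_power a n.  If x <= a then N y >= n and
    (1 - y)^N <= e^(-N y) <= e^(-n); if a < x then Bernoulli's inequality gives
    (1 - y)^N >= 1 - N y >= 1 - 2 n e^(-n (x - a)). *)
Lemma cvg_cutoff_power a x : 0 <= a -> 0 < x ->
  (1 - expR (- (n%:R * x))) ^+ cutoff_power a n @[n --> \oo] --> ((a < x)%R%:R : R).
Proof.
move=> a0 x0.
have q01 n : 0 <= 1 - expR (- (n%:R * x)) <= 1.
  rewrite subr_ge0 -expR0 ler_expR oppr_le0 mulr_ge0 ?(ltW x0)//=.
  by rewrite expR0 gerBl expR_ge0.
have [ax|xa] := ltP a x.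
- apply: (@squeeze_cvgr _ _ _ _ (fun n => 1 - (n%:R * expR (- (n%:R * (x - a)))) *+ 2) (cst 1)).
  + apply: nearW => n; have /andP[q0 q1] := q01 n.
    apply/andP; split; last exact: exprn_ile1.
    have bern m (y : R) : 0 <= y <= 1 -> 1 - m%:R * y <= (1 - y) ^+ m.
      move=> /andP[y0 y1]; elim: m => [|m IH]; first by rewrite mul0r subr0 expr0.
      rewrite exprS; apply: (@le_trans _ _ ((1 - y) * (1 - m%:R * y))).
        have : 0 <= m%:R * y ^+ 2 by rewrite mulr_ge0// sqr_ge0.
        by rewrite -natr1 expr2; nra.
      by rewrite ler_wpM2l// subr_ge0.
    apply: le_trans (bern _ _ _); last first.
      by rewrite expR_ge0 -[leRHS]expR0 ler_expR oppr_le0 mulr_ge0 ?(ltW x0).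
    rewrite lerD2l lerN2 /cutoff_power natrM -mulrA -mulrnAr.
    rewrite ler_wpM2l//.
    have -> : - (n%:R * (x - a)) = n%:R * a - n%:R * x by lra.
    rewrite expRD -mulrnAl ler_wpM2r ?expR_ge0//.
    rewrite -natr1 mulr2n lerD//; first by rewrite truncn_le expR_ge0.
    by rewrite -[leLHS]expR0 ler_expR mulr_ge0.
  + rewrite -[X in _ --> X]subr0; apply: cvgB; first exact: cvg_cst.
    by rewrite -(mul0rn _ 2); apply: cvgMn; apply: cvg_natM_expR_opp; rewrite subr_gt0.
  + exact: cvg_cst.
- apply: (@squeeze_cvgr _ _ _ _ (cst 0) (fun n => expR (- n%:R))).
  + apply: nearW => n; have /andP[q0 q1] := q01 n.
    apply/andP; split; first exact: exprn_ge0.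
    apply: (@le_trans _ _ (expR (- expR (- (n%:R * x))) ^+ cutoff_power a n)).
      rewrite lerXn2r ?nnegrE ?expR_ge0//.
      exact: expR_ge1Dx.
    rewrite -expRM_natl ler_expR mulrN lerN2 /cutoff_power natrM -mulrA.
    rewrite ler_peMr// expRN ler_pdivlMr ?expR_gt0// mul1r.
    apply: le_trans (ltW (truncnS_gt _)).
    by rewrite ler_expR ler_wpM2l.
  + exact: cvg_cst.
  + have := @cvgr_expR R => h.
    exact: (cvg_comp _ _ (@cvgr_idn R) h).
Qed.

End cutoff_powers.

(** * Uniqueness of the measure with a given exponent *)

Section laplace_uniqueness.
Context {R : realType}.
Implicit Types (a c x : R).
Local Notation S := (`]0%R, +oo[%classic : set R).

Lemma measurable_one_sub_expRM c :
  measurable_fun setT (fun x : R => 1 - expR (- (c * x))).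
Proof.
apply: measurable_funB => //; apply: measurableT_comp => //.
apply: measurableT_comp => //; exact: measurable_funM.
Qed.

Lemma one_sub_expRM_itv c x : 0 <= c -> 0 < x -> 0 <= 1 - expR (- (c * x)) <= 1.
Proof.
move=> c0 x0; rewrite subr_ge0 gerBl expR_ge0 andbT.
by rewrite -[leRHS]expR0 ler_expR oppr_le0 mulr_ge0 ?(ltW x0).
Qed.

(** The Bernstein function Phi of a Levy measure without drift. *)
Definition laplace_exponent (n : {measure set (measurableTypeR R) -> \bar R}) c : \bar R :=
  (\int[n]_(x in S) (1 - expR (- (c * x)))%:E)%E.

(** The power (1 - e^(-c x))^N carries the factor 1 - e^(-x), which makes it
    integrable against a Levy measure, and e^(-lambda x), which gives the
    induction on N its room. *)
Definition tilted_power c (N : nat) lambda x : R :=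
  expR (- (lambda * x)) * (1 - expR (- (1 * x))) * (1 - expR (- (c * x))) ^+ N.

Lemma measurable_tilted_power c N lambda :
  measurable_fun setT (EFin \o tilted_power c N lambda).
Proof.
apply/measurable_EFinP; apply: measurable_funM; first apply: measurable_funM.
- apply: measurableT_comp => //; apply: measurableT_comp => //; exact: measurable_funM.
- exact: measurable_one_sub_expRM.
- by apply: measurable_funX; exact: measurable_one_sub_expRM.
Qed.

Lemma integrable_one_sub_expRM (n : {measure set (measurableTypeR R) -> \bar R}) c :
  0 <= c -> (laplace_exponent n c < +oo)%E ->
  n.-integrable S (fun x => (1 - expR (- (c * x)))%:E).
Proof.
move=> c0 fin; apply/integrableP; split.
  by apply: measurable_funTS; apply/measurable_EFinP; exact: measurable_one_sub_expRM.
apply: le_lt_trans fin; rewrite /laplace_exponent le_eqVlt; apply/orP; left; apply/eqP.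
apply: eq_integral => x; rewrite inE /mkset /= in_itv/= andbT => x0.
by rewrite ger0_norm//; have /andP[] := one_sub_expRM_itv c0 x0.
Qed.

Lemma integrable_tilted_power (n : {measure set (measurableTypeR R) -> \bar R}) c N lambda :
  0 <= c -> 0 <= lambda -> (laplace_exponent n 1 < +oo)%E ->
  n.-integrable S (EFin \o tilted_power c N lambda).
Proof.
move=> c0 l0 fin.
apply: le_integrable (integrable_one_sub_expRM ler01 fin) => //.
  by apply: measurable_funTS; exact: measurable_tilted_power.
move=> x; rewrite /mkset /= in_itv/= andbT => x0.
have /andP[a0 a1] := one_sub_expRM_itv ler01 x0.
have /andP[b0 b1] := one_sub_expRM_itv c0 x0.
rewrite lee_fin /tilted_power !ger0_norm ?mulr_ge0 ?exprn_ge0 ?expR_ge0//.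
rewrite -mulrA mulrCA -[leRHS]mulr1 ler_wpM2l//.
rewrite mulr_ile1 ?expR_ge0 ?exprn_ge0 ?exprn_ile1//.
by rewrite -[leRHS]expR0 ler_expR oppr_le0 mulr_ge0// ltW.
Qed.

(** Induction on N, for all lambda at once, from
    F (N + 1) lambda = F N lambda - F N (lambda + c); for N = 0 the integral is
    Phi(lambda + 1) - Phi(lambda). *)
Lemma integral_tilted_power_eq (n1 n2 : {measure set (measurableTypeR R) -> \bar R}) :
  (forall c, 0 < c -> (laplace_exponent n1 c < +oo)%E) ->
  (forall c, 0 < c -> laplace_exponent n1 c = laplace_exponent n2 c) ->
  forall c N lambda, 0 <= c -> 0 <= lambda ->
  (\int[n1]_(x in S) (tilted_power c N lambda x)%:E =
   \int[n2]_(x in S) (tilted_power c N lambda x)%:E)%E.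
Proof.
move=> fin1 e12 c N lambda c0.
have fin2 l : 0 < l -> (laplace_exponent n2 l < +oo)%E.
  by move=> l0; rewrite -e12// fin1.
have e0 n : laplace_exponent n 0 = 0%E.
  by apply: integral0_eq => x _; rewrite mul0r oppr0 expR0 subrr.
have fin1' l : 0 <= l -> (laplace_exponent n1 l < +oo)%E.
  by rewrite le_eqVlt => /predU1P[<-|]; [rewrite e0 ltry|exact: fin1].
have fin2' l : 0 <= l -> (laplace_exponent n2 l < +oo)%E.
  by rewrite le_eqVlt => /predU1P[<-|]; [rewrite e0 ltry|exact: fin2].
have e12' l : 0 <= l -> laplace_exponent n1 l = laplace_exponent n2 l.
  by rewrite le_eqVlt => /predU1P[<-|]; [rewrite !e0|exact: e12].
elim: N lambda => [|N IH] l l0.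
- have h n : (forall l, 0 <= l -> (laplace_exponent n l < +oo)%E) ->
      (\int[n]_(x in S) (tilted_power c 0 l x)%:E =
       laplace_exponent n (l + 1) - laplace_exponent n l)%E.
    move=> fin; rewrite /laplace_exponent -integralB//; last 2 first.
    + by apply: integrable_one_sub_expRM; [rewrite addr_ge0|rewrite fin// addr_ge0].
    + by apply: integrable_one_sub_expRM => //; exact: fin.
    apply: eq_integral => x _; rewrite -EFinB; congr EFin.
    by rewrite /tilted_power expr0 mulrDl opprD expRD; ring.
  by rewrite !h// !e12'// addr_ge0.
- have h n : (laplace_exponent n 1 < +oo)%E ->
      (\int[n]_(x in S) (tilted_power c N.+1 l x)%:E =
       \int[n]_(x in S) (tilted_power c N l x)%:E -
       \int[n]_(x in S) (tilted_power c N (l + c) x)%:E)%E.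
    move=> fin; rewrite -integralB//; last 2 first.
    + exact: integrable_tilted_power.
    + by apply: integrable_tilted_power => //; rewrite addr_ge0.
    apply: eq_integral => x _; rewrite -EFinB; congr EFin.
    by rewrite /tilted_power exprS (mulrDl l c x) opprD expRD; ring.
  by rewrite !h ?fin1 ?fin2// !IH// addr_ge0.
Qed.

Lemma integral_tilted_tail_eq (n1 n2 : {measure set (measurableTypeR R) -> \bar R}) :
  (forall c, 0 < c -> (laplace_exponent n1 c < +oo)%E) ->
  (forall c, 0 < c -> laplace_exponent n1 c = laplace_exponent n2 c) ->
  forall a, 0 <= a ->
  (\int[n1]_(x in `]a, +oo[) (1 - expR (- (1 * x)))%:E =
   \int[n2]_(x in `]a, +oo[) (1 - expR (- (1 * x)))%:E)%E.
Proof.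
move=> fin1 e12 a a0.
pose F k x := (tilted_power k%:R (cutoff_power a k) 0 x)%:E.
have cvgF (n : {measure set (measurableTypeR R) -> \bar R}) :
    (laplace_exponent n 1 < +oo)%E ->
    (\int[n]_(x in S) F k x @[k --> \oo] -->
     \int[n]_(x in `]a, +oo[) (1 - expR (- (1 * x)))%:E)%E.
  move=> fin.
  have -> : (\int[n]_(x in `]a, +oo[) (1 - expR (- (1 * x)))%:E =
      \int[n]_(x in S) ((1 - expR (- (1 * x))) * (a < x)%R%:R)%:E)%E.
    rewrite integral_mkcond [RHS]integral_mkcond; apply: eq_integral => x _.
    rewrite !patchE !mem_setE !in_itv/= !andbT.
    case: (ltP a x) => ax; first by rewrite (le_lt_trans a0 ax) mulr1.
    by rewrite mulr0; case: ifP.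
  apply: (@dominated_cvg _ _ R n S _ F (fun x => ((1 - expR (- (1 * x))) * (a < x)%R%:R)%:E)
    (fun x => (1 - expR (- (1 * x)))%:E)) => //.
  - by move=> k; apply: measurable_funTS; exact: measurable_tilted_power.
  - move=> x; rewrite /mkset /= in_itv/= andbT => x0.
    apply: cvg_EFin; first exact: nearW.
    rewrite /F /tilted_power.
    under eq_fun do rewrite mul0r oppr0 expR0 mul1r.
    by apply: cvgM; [exact: cvg_cst|exact: cvg_cutoff_power].
  - exact: integrable_one_sub_expRM.
  - move=> k x; rewrite /mkset /= in_itv/= andbT => x0.
    have /andP[u0 u1] := one_sub_expRM_itv ler01 x0.
    have /andP[v0 v1] := one_sub_expRM_itv (ler0n R k) x0.
    rewrite /F /tilted_power lee_fin mul0r oppr0 expR0 mul1r ger0_norm ?mulr_ge0 ?exprn_ge0//.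
    by rewrite ler_piMr// exprn_ile1.
have c1 := cvgF n1 (fin1 1 ltr01).
have := cvgF n2; rewrite -e12// => /(_ (fin1 1 ltr01)) c2.
have n12 : (fun k => \int[n1]_(x in S) F k x)%E = (fun k => \int[n2]_(x in S) F k x)%E.
  by apply/funext => k; exact: integral_tilted_power_eq.
by apply: (cvg_unique _ c1) => //; rewrite n12.
Qed.

(** The tilted measures (1 - e^(-x)) n_i(dx) are finite and agree on half-lines,
    hence on Borel sets; dividing by the tilt, which is positive on ]0, +oo[,
    recovers the n_i. *)
Lemma laplace_exponent_unique (n1 n2 : {measure set (measurableTypeR R) -> \bar R}) :
  (forall c, 0 < c -> (laplace_exponent n1 c < +oo)%E) ->
  (forall c, 0 < c -> laplace_exponent n1 c = laplace_exponent n2 c) ->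
  forall A, measurable A -> A `<=` S -> n1 A = n2 A.
Proof.
move=> fin1 e12 A mA AS.
pose g x := Num.max 0 (1 - expR (- (1 * x))).
have g0 x : 0 <= g x by rewrite /g le_max lexx.
have mg : measurable_fun setT g.
  by apply: measurable_maxr => //; exact: measurable_one_sub_expRM.
have gS x : 0 < x -> g x = 1 - expR (- (1 * x)).
  move=> x0; apply/max_idPr.
  by have /andP[] := one_sub_expRM_itv ler01 x0.
have gnS x : x <= 0 -> g x = 0.
  move=> x0; apply/max_idPl; rewrite subr_le0 -[leLHS]expR0 ler_expR.
  by rewrite mul1r oppr_ge0.
pose nu (n : {measure set (measurableTypeR R) -> \bar R}) :
    {measure set (measurableTypeR R) -> \bar R} := density_measure n mg g0.
have nuD n B : nu n B = (\int[n]_(x in B) (g x)%:E)%E by [].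
have nuE n a : 0 <= a ->
    nu n `]a, +oo[%classic = (\int[n]_(x in `]a, +oo[) (1 - expR (- (1 * x)))%:E)%E.
  move=> a0; apply: eq_integral => x; rewrite inE /mkset /= in_itv/= andbT => ax.
  by rewrite gS// (le_lt_trans a0).
have nuN n a : a < 0 -> nu n `]a, +oo[%classic = nu n S.
  move=> a0; rewrite !nuD integral_mkcond [RHS]integral_mkcond.
  apply: eq_integral => x _; rewrite !patchE !mem_setE !in_itv/= !andbT.
  case: (ltP 0 x) => x0; first by rewrite (lt_trans a0 x0).
  by rewrite gnS//; case: ifP.
have nutail a : nu n1 `]a, +oo[%classic = nu n2 `]a, +oo[%classic.
  have [a0|a0] := leP 0 a; last by rewrite !nuN// !nuE//; exact: integral_tilted_tail_eq.
  by rewrite !nuE//; exact: integral_tilted_tail_eq.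
have nu12 B : measurable B -> nu n1 B = nu n2 B.
  apply: (@measure_unique _ R (measurableTypeR R) (@RGenOInfty.G R)
    (fun k => `]- k%:R, +oo[%classic) _ _ _ _ (nu n1) (nu n2)).
  - exact: RGenOInfty.measurableE.
  - move=> _ _ [x ->] [y ->]; exists (Num.max x y).
    by apply/seteqP; split=> z; rewrite /setI /mkset /= !in_itv/= !andbT gt_max => /andP.
  - by move=> k; eexists.
  - apply/seteqP; split=> // x _; exists (Num.truncn `|x|).+1 => //.
    rewrite /mkset /= in_itv/= andbT ltrNl.
    by rewrite (le_lt_trans _ (truncnS_gt _))// -normrN ler_norm.
  - by move=> _ [x ->]; exact: nutail.
  - move=> k; have [k0|k0] := leP 0 (- (k%:R : R)).
      have -> : - (k%:R : R) = 0.
        by apply/eqP; rewrite eq_le k0 oppr_le0 ler0n.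
      by rewrite nuE//; exact: fin1.
    by rewrite nuN// nuE//; exact: fin1.
pose f x := (\1_A x * g x `^ (-1))%:E.
have mf : measurable_fun setT f.
  apply/measurable_EFinP; apply: measurable_funM; first exact: measurable_indic.
  exact: measurableT_comp (measurable_powR _) mg.
have nA (n : {measure set (measurableTypeR R) -> \bar R}) : n A = (\int[nu n]_x f x)%E.
  rewrite (@ge0_integral_density _ _ R n (nu n) g f mg g0)//; last first.
    by move=> x; rewrite lee_fin mulr_ge0 ?powR_ge0.
  transitivity (\int[n]_x (\1_A x)%:E)%E; first by rewrite integral_indic// setIT.
  apply: eq_integral => x _; rewrite -EFinM powR_inv1// indicE; congr EFin.
  case: (boolP (x \in A)) => [|_]; last by rewrite !mul0r.
  rewrite inE => /AS; rewrite /mkset /= in_itv/= andbT => x0.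
  rewrite mul1r mulVf// gS// subr_eq0 eq_sym lt_eqF//.
  by rewrite -[ltRHS]expR0 ltr_expR mul1r oppr_lt0.
rewrite !nA; apply: eq_measure_integral => B mB _; exact: nu12.
Qed.

End laplace_uniqueness.

(** * The Bessel process at a fixed time *)

Section filtrations.
Context (d : measure_display) (T : measurableType d) (R : realType).
Variables (P : probability T R) (X : R -> {RV P >-> R}).

Lemma natural_filtration_measurable t :
  natural_filtration (fun s => X s : T -> R) t `<=` measurable.
Proof.
apply: smallest_sub; first exact: sigma_algebra_measurable.
by move=> _ [r _ [B mB <-]]; exact: measurable_funPT.
Qed.

Lemma natural_filtrationT t : natural_filtration (fun s => X s : T -> R) t setT.
Proof. exact: (@measurableT _ (g_sigma_algebraType _)). Qed.

Lemma usual_augmentation_measurable t :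
  usual_augmentation P (natural_filtration (fun s => X s : T -> R)) t `<=` measurable.
Proof.
move=> A /(_ (t + 1)); rewrite /mkset /= in_itv/= andbT ltrDl => /(_ ltr01).
apply: smallest_sub; first exact: sigma_algebra_measurable.
by move=> B [|[]//]; exact: natural_filtration_measurable.
Qed.

Lemma usual_augmentationT (F : R -> set (set T)) t : usual_augmentation P F t setT.
Proof. move=> s _; exact: (@measurableT _ (g_sigma_algebraType _)). Qed.

Lemma adapted_measurable (L : R -> T -> R) t :
  adapted (usual_augmentation P (natural_filtration (fun s => X s : T -> R))) L ->
  0 <= t -> measurable_fun setT (L t).
Proof.
move=> aL t0 _ B mB; apply: (@usual_augmentation_measurable t).
by apply: aL => //; exists B.
Qed.

End filtrations.

Section bessel_moment.
Context {R : realType}.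
Local Notation leb := (@lebesgue_measure R).

(** A primitive is - t e^(-y^2 / 2t). *)
Lemma integral_id_gauss (t : R) : 0 < t ->
  (\int[leb]_(y in `]0%R, +oo[) (y * expR (- (y ^+ 2) / (2 * t)))%:E = t%:E)%E.
Proof.
move=> t0.
pose F (y : R) := - t * expR (- (2 * t)^-1 * y ^+ 2).
have FE y : expR (- (y ^+ 2) / (2 * t)) = expR (- (2 * t)^-1 * y ^+ 2) :> R.
  by congr expR; rewrite mulNr mulrC mulNr.
under eq_integral do rewrite FE.
have dX (y : R) : is_derive y 1 (fun z : R => - (2 * t)^-1 * z ^+ 2) (- (2 * t)^-1 * (2 * y)).
  apply: is_deriveZ.
  have := @is_deriveX R R id 2 y 1 1 (is_derive_id _ _).
  by rewrite /GRing.scale/= mulr1 expr1.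
have dF (y : R) : is_derive y 1 F (y * expR (- (2 * t)^-1 * y ^+ 2)).
  have h := @is_derive1_comp R expR _ y _ _ (is_derive_expR _) (dX y).
  apply: (@is_derive_eq _ _ _ _ _ _ _
    (- t *: (expR (- (2 * t)^-1 * y ^+ 2) * (- (2 * t)^-1 * (2 * y))))).
  rewrite /GRing.scale/=; field; exact: lt0r_neq0.
have cF : continuous F.
  move=> y; apply: differentiable_continuous; apply/derivable1_diffP.
  by have [] := dF y.
have cf : continuous (fun y : R => y * expR (- (2 * t)^-1 * y ^+ 2)).
  have -> : (fun y : R => y * expR (- (2 * t)^-1 * y ^+ 2)) =
      (fun y => y * ((- t)^-1 * F y)).
    by apply/funext => y; rewrite /F mulKf// oppr_eq0 gt_eqF.
  move=> y; apply: cvgM; first exact: cvg_id.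
  by apply: cvgM; [exact: cvg_cst|exact: cF].
rewrite integral_itv_obnd_cbnd; last first.
  by apply: measurable_funTS; apply/measurable_EFinP; exact: continuous_measurable_fun.
rewrite (@ge0_continuous_FTC2y _ _ F _ 0).
- by rewrite -EFinB /F expr0n mulr0 expR0 mulr1 sub0r opprK.
- by move=> x x0; rewrite mulr_ge0 ?expR_ge0.
- exact: continuous_subspaceT.
- rewrite -[X in _ --> X](mulr0 (- t)); apply: cvgM; first exact: cvg_cst.
  under eq_fun do rewrite mulNr.
  apply: (@cvg_comp _ _ _ (fun y : R => (2 * t)^-1 * y ^+ 2) (fun z => expR (- z))
    _ (pinfty_nbhs R)); last exact: cvgr_expR.
  by apply: gt0_cvgMry; [rewrite invr_gt0 mulr_gt0|exact: cvgr_expr2].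
- by move=> x _; have [] := dF x.
- by apply: cvg_at_right_filter; exact: cF.
- by move=> x _; rewrite derive1E; have [_ ->] := dF x.
Qed.

End bessel_moment.

Section bessel_at_fixed_time.
Context (d : measure_display) (T : measurableType d) (R : realType).
Variables (P : probability T R) (X : R -> {RV P >-> R}) (mu : R).
Hypothesis mu01 : 0 < mu < 1.
Local Notation leb := (@lebesgue_measure R).

(** The Markov property at time 0 on the sure event, as the process starts from
    the constant 0. *)
Lemma bessel_law (delta t : R) (B : set (measurableTypeR R)) :
  bessel_process_from0 P delta X -> 0 < t -> measurable B ->
  P (X t @^-1` B) =
    (\int[leb]_(y in B `&` `]0%R, +oo[) (bessel_density delta t 0 y)%:E)%E.
Proof.
move=> [_ _ X0 markov] t0 mB.
have := markov 0 t setT B (lexx 0) t0 (@natural_filtrationT _ _ _ P X 0) mB.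
rewrite setTI add0r => ->.
under eq_integral do rewrite X0.
transitivity (bessel_kernel delta t 0 B * P setT)%E; first exact: integral_cst.
by rewrite probability_setT mule1.
Qed.

(** This is why the exponent 2 mu is the right one: the entrance density carries
    y^(1 - 2 mu), and y^(2 mu) turns it into the exact differential
    y e^(-y^2 / 2t) dy. *)
Lemma bessel_density0 (t y : R) : 0 < t -> 0 < y ->
  y `^ (2 * mu) * bessel_density (2 * (1 - mu)) t 0 y =
  2 `^ mu * t `^ (mu - 1) / Gamma (1 - mu) * (y * expR (- (y ^+ 2) / (2 * t))).
Proof.
move=> t0 y0; rewrite /bessel_density eqxx.
have -> : 2 * (1 - mu) / 2 - 1 = - mu by field.
rewrite opprK.
have -> : - mu + 1 = 1 - mu by rewrite addrC.
rewrite opprB.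
have -> : y * expR (- y ^+ 2 / (2 * t)) =
    y `^ (2 * mu) * y `^ (- mu *+ 2 + 1) * expR (- y ^+ 2 / (2 * t)).
  congr (_ * _); rewrite -powRD ?(gt_eqF y0) ?implybT// -[LHS]powRr1 ?ltW//.
  by congr (_ `^ _); ring.
ring.
Qed.

Lemma expectation_bessel_power (t : R) :
  bessel_process_from0 P (2 * (1 - mu)) X -> 0 <= t ->
  (\int[P]_w (X t w `^ (2 * mu))%:E = (2 `^ mu * t `^ mu / Gamma (1 - mu))%:E)%E.
Proof.
have [mu0 mu1] := andP mu01.
move=> bX; rewrite le_eqVlt => /predU1P[<-|t0].
  have [_ _ X0 _] := bX.
  rewrite integral0_eq => [|w _]; first by rewrite powR0 ?gt_eqF// mulr0 mul0r.
  by rewrite X0 powR0// mulf_neq0 ?gt_eqF.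
have G0 : 0 < Gamma (1 - mu) by apply: Gamma_gt0; rewrite subr_gt0 mu1 lerBlDr lerDl ltW.
pose K := 2 `^ mu * t `^ (mu - 1) / Gamma (1 - mu).
have K0 : 0 <= K by rewrite !mulr_ge0 ?powR_ge0 ?invr_ge0 ?(ltW G0).
pose g y := \1_(`]0%R, +oo[%classic) y * bessel_density (2 * (1 - mu)) t 0 y.
have mdens : measurable_fun setT (bessel_density (2 * (1 - mu)) t 0 : R -> R).
  rewrite /bessel_density eqxx; apply: measurable_funM; first exact: measurable_funM.
  apply: measurableT_comp => //; apply: measurable_funM => //.
  by apply: measurableT_comp => //; exact: measurable_funX.
have mg : measurable_fun setT g by apply: measurable_funM => //; exact: measurable_indic.
have g0 y : 0 <= g y.
  rewrite /g indicE; case: (boolP (y \in _)) => [|_]; last by rewrite mul0r.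
  rewrite inE /mkset /= in_itv/= andbT => y0; rewrite mul1r.
  have : 0 <= y `^ (2 * mu) * bessel_density (2 * (1 - mu)) t 0 y.
    by rewrite bessel_density0// mulr_ge0// mulr_ge0 ?expR_ge0 ?ltW.
  by rewrite pmulr_rge0// powR_gt0.
have mp : measurable_fun setT (fun y : R => (y `^ (2 * mu))%:E).
  by apply/measurable_EFinP; exact: measurable_powR.
(* The law has to live on the measurable space that carries Lebesgue measure. *)
pose phi : T -> measurableTypeR R := X t.
have mphi : measurable_fun setT phi by move=> _ B mB; exact: measurable_funPT.
pose law : {measure set (measurableTypeR R) -> \bar R} :=
  measure_function_pushforward__canonical__measure_function_Measure P mphi.
transitivity (\int[law]_y (y `^ (2 * mu))%:E)%E.
  rewrite (@ge0_integral_pushforward _ _ _ _ R phi mphi P setT (fun y => (y `^ (2 * mu))%:E))//.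
  by move=> y _; rewrite lee_fin powR_ge0.
rewrite (@ge0_integral_density _ _ R leb law g (fun y => (y `^ (2 * mu))%:E))//; last 2 first.
- move=> B mB; rewrite /law /= /pushforward (bessel_law bX t0)//.
  rewrite integral_mkcondr; apply: eq_integral => y _.
  by rewrite /g patchE indicE; case: ifP => _; rewrite ?mul1r ?mul0r.
- by move=> y; rewrite lee_fin powR_ge0.
transitivity (\int[leb]_(y in `]0%R, +oo[) (K%:E * (y * expR (- (y ^+ 2) / (2 * t)))%:E))%E.
  rewrite [RHS]integral_mkcond; apply: eq_integral => y _.
  rewrite patchE /g indicE; case: ifPn => [|_]; last by rewrite mul0r mule0.
  rewrite inE /mkset /= in_itv/= andbT => y0.
  by rewrite mul1r -!EFinM bessel_density0.
rewrite ge0_integralZl_EFin//; last 2 first.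
- by move=> y; rewrite /mkset /= in_itv/= andbT => y0; rewrite lee_fin mulr_ge0 ?expR_ge0 ?ltW.
- apply: measurable_funTS; apply/measurable_EFinP; apply: measurable_funM => //.
  apply: measurableT_comp => //; apply: measurable_funM => //.
  by apply: measurableT_comp => //; exact: measurable_funX.
rewrite integral_id_gauss// -EFinM; congr EFin; rewrite /K.
by rewrite -(mulr_powRB1 (ltW t0) mu0); ring.
Qed.

End bessel_at_fixed_time.

(** * The local time and its inverse *)

Section local_time.
Context (d : measure_display) (T : measurableType d) (R : realType).
Variables (P : probability T R) (mu : R).
Hypothesis mu01 : 0 < mu < 1.
Local Notation leb := (@lebesgue_measure R).

(** The martingale R^(2 mu) - L vanishes at time 0, so it has mean 0. *)
Lemma expectation_local_time (X : R -> {RV P >-> R}) (L : R -> T -> R) (t : R) :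
  bessel_process_from0 P (2 * (1 - mu)) X -> bessel_local_time P mu X L -> 0 <= t ->
  (\int[P]_w (L t w)%:E = (2 `^ mu * t `^ mu / Gamma (1 - mu))%:E)%E.
Proof.
have [mu0 mu1] := andP mu01.
move=> bX [_ aL ndL L0 [_ intM martM]] t0.
have [_ _ X0 _] := bX.
have eX := expectation_bessel_power mu01 bX t0.
pose Y (w : T) := (X t w `^ (2 * mu))%:E.
have mY : measurable_fun setT Y.
  apply/measurable_EFinP; apply: measurableT_comp (measurable_powR _) _.
  exact: measurable_funP.
have intY : P.-integrable setT Y.
  apply/integrableP; split => //.
  under eq_integral do rewrite gee0_abs ?lee_fin ?powR_ge0//.
  by rewrite eX ltry.
have M0 := martM 0 t setT (lexx 0) t0 (@usual_augmentationT _ _ _ P _ 0).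
have {}M0 : (\int[P]_w (X t w `^ (2 * mu) - L t w)%:E = 0)%E.
  rewrite M0; apply: integral0_eq => w _.
  by rewrite X0 L0 powR0 ?subr0// mulf_neq0 ?gt_eqF.
transitivity (\int[P]_w (Y w - (X t w `^ (2 * mu) - L t w)%:E))%E.
  by apply: eq_integral => w _; rewrite /Y -EFinB subKr.
by rewrite integralB// ?M0 ?sube0//; exact: intM.
Qed.

Section inverse.
Variable L : R -> T -> R.
Hypotheses (cL : continuous_paths L)
  (ndL : forall s t w, 0 <= s -> s <= t -> L s w <= L t w)
  (L0 : forall w, L 0 w = 0).

(** Left continuity at t. *)
Lemma exceeds_earlier (u t : R) (w : T) :
  0 < t -> u < L t w -> exists y, [/\ 0 < y, y < t & u < L y w].
Proof.
move=> t0 ut.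
have /continuous_within_itvcyP[ct _] := @cL w.
have {}ct : {for t, continuous (L ^~ w)} by apply: ct; rewrite in_itv/= t0.
have nu : \forall y \near t^'-, u < L y w.
  by apply: (@cvgr_gt _ _ _ _ (L ^~ w) (L t w)) => //; exact: cvg_at_left_filter.
near t^'- => y; exists y; split.
- by near: y; exact: nbhs_left_gt.
- by near: y; exact: nbhs_left_lt.
- by near: y.
Unshelve. all: by end_near. Qed.

(** The domain is ]tau_u, +oo[: upward closed because L is nondecreasing, and
    without least element by [exceeds_earlier].  It is empty when tau_u = +oo,
    and both sides are then 0. *)
Lemma integral_exp_after_inverse (lambda u : R) (w : T) : 0 < lambda -> 0 <= u ->
  (\int[leb]_(t in [set t | (0 < t /\ u < L t w)%R]) (lambda * expR (- (lambda * t)))%:E =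
   expeR (- (lambda%:E * inverse_local_time L u w)))%E.
Proof.
move=> l0 u0.
set A := [set t | _]; set tau := inverse_local_time L u w.
have A_pos t : 0 <= t -> u < L t w -> 0 < t.
  by rewrite le_eqVlt => /predU1P[<-|//]; rewrite L0 ltNge u0.
have tauE : tau = ereal_inf [set t%:E | t in A].
  congr ereal_inf; apply/seteqP; split=> _ [t [t0 ut] <-]; exists t => //; split=> //.
    exact: A_pos.
  exact: ltW.
have [A0|/set0P[t1 At1]] := eqVneq A set0.
  by rewrite tauE A0 image_set0 ereal_inf0 integral_set0 gt0_muley ?lte_fin.
have tau_le t : A t -> (tau <= t%:E)%E.
  by move=> At; rewrite tauE; apply: ereal_inf_lbound; exists t.
have tau0 : (0 <= tau)%E.
  by rewrite tauE; apply: le_ereal_inf_tmp => _ [t [t0 _] <-]; rewrite lee_fin ltW.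
have [s sE] : exists s, tau = s%:E.
  by move: tau0 (tau_le _ At1); case: (tau) => [r| |]//; exists r.
have s0 : 0 <= s by rewrite -lee_fin -sE.
have -> : A = `]s, +oo[%classic.
  apply/seteqP; split=> t; rewrite /mkset /= in_itv/= andbT.
  - move=> [t0 ut]; have := tau_le t (conj t0 ut).
    rewrite sE lee_fin; case: ltgtP => // st _; exfalso.
    have [y [y0 yt uy]] := exceeds_earlier t0 ut.
    by have := tau_le y (conj y0 uy); rewrite sE lee_fin leNgt st yt.
  - move=> st; have : (tau < t%:E)%E by rewrite sE lte_fin.
    rewrite tauE => /ereal_inf_lt[_ [r [r0 ur] <-]]; rewrite lte_fin => rt.
    split; first exact: lt_trans rt.
    by apply: lt_le_trans ur _; apply: ndL; exact: ltW.
by rewrite integral_exp_tail// sE.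
Qed.

Hypothesis mL : forall t, 0 <= t -> measurable_fun setT (L t).

Definition excess_set : set ((R * R) * T) :=
  [set z | [/\ 0 < z.1.1, 0 < z.1.2 & z.1.2 < L z.1.1 z.2]].

(** By monotonicity and [exceeds_earlier], the level u is exceeded at time t
    exactly when it is exceeded at some positive rational time before t; so
    measurability of each L_q is enough. *)
Lemma measurable_excess_set : measurable excess_set.
Proof.
(* The condition 0 < q is needed, as L is monotone on [0, +oo[ only. *)
pose G (q : rat) : set ((R * R) * T) := if 0 < q then
  [set z | 0 < z.1.2] `&` [set z | ratr q < z.1.1] `&` [set z | z.1.2 < L (ratr q) z.2]
  else set0.
have -> : excess_set = \bigcup_q G q.
  apply/seteqP; split=> [[[t u] w] /= [t0 u0 ut]|[[t u] w] [q _]].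
    have [y [y0 yt uy]] := exceeds_earlier t0 ut.
    have [q] := rat_in_itvoo yt; rewrite in_itv/= => /andP[yq qt].
    exists q => //; rewrite /G -(ltr0q R) (lt_trans y0 yq); split => //=.
    by apply: lt_le_trans uy _; apply: ndL; exact: ltW.
  rewrite /G; case: ifPn => // q0 [[/= u0 qt] uq].
  have qR : 0 < ratr q :> R by rewrite ltr0q.
  split=> //=; first exact: lt_trans qt.
  by apply: lt_le_trans uq _; apply: ndL; exact: ltW.
apply: bigcupT_measurable_rat => q; rewrite /G; case: ifPn => // q0.
have m1 : measurable_fun setT (fun z : (R * R) * T => z.1.1).
  by apply: measurableT_comp => //; exact: measurable_fst.
have m2 : measurable_fun setT (fun z : (R * R) * T => z.1.2).
  by apply: measurableT_comp => //; exact: measurable_snd.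
have m3 : measurable_fun setT (fun z : (R * R) * T => L (ratr q) z.2).
  by apply: measurableT_comp => //; apply: mL; rewrite ler0q ltW.
by apply: measurableI; [apply: measurableI|]; exact: measurable_set_ltr.
Qed.

(** With c = lambda, both sides are the integral of c e^(-c t) over the region
    0 < u < L_t in the variables (t, u, w): integrating in u first produces L_t,
    integrating in t first produces e^(-c tau_u). *)
Lemma laplace_inverse_local_time (lambda : R) : 0 < lambda ->
  (\int[leb]_(t in `]0%R, +oo[)
     ((lambda * expR (- (lambda * t)))%:E * \int[P]_w (L t w)%:E) =
   \int[leb]_(u in `]0%R, +oo[)
     \int[P]_w expeR (- (lambda%:E * inverse_local_time L u w)))%E.
Proof.
move=> l0.
pose k (t : R) := lambda * expR (- (lambda * t)).
have k0 t : 0 <= k t by rewrite mulr_ge0 ?expR_ge0 ?ltW.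
have mk : measurable_fun setT k := continuous_measurable_fun (@continuous_exp_density _ lambda).
pose f (z : (R * R) * T) : \bar R := (k z.1.1 * \1_excess_set z)%:E.
have mf : measurable_fun setT f.
  apply/measurable_EFinP; apply: measurable_funM.
    apply: measurableT_comp => //; apply: measurableT_comp => //; exact: measurable_fst.
  by apply: measurable_indic; exact: measurable_excess_set.
have f0 z : (0 <= f z)%E by rewrite lee_fin mulr_ge0.
have Lge0 t w : 0 <= t -> 0 <= L t w by move=> t0; rewrite -(L0 w); exact: ndL.
have memG t u w : (((t, u), w) \in excess_set) = [&& 0 < t, 0 < u & u < L t w].
  by apply/idP/and3P; rewrite inE.
transitivity (\int[leb]_t \int[P]_w \int[leb]_u f ((t, u), w))%E.
  rewrite integral_mkcond; apply: eq_integral => t _; rewrite patchE mem_setE in_itv/= andbT.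
  case: ifPn => [t0|/negbTE t0]; last first.
    rewrite integral0_eq// => w _; rewrite integral0_eq// => u _.
    by rewrite /f indicE memG t0 mulr0.
  rewrite -ge0_integralZl_EFin//; last 3 first.
  - by move=> w _; rewrite lee_fin Lge0 ?ltW.
  - by apply/measurable_EFinP; apply: mL; exact: ltW.
  - exact: k0.
  apply: eq_integral => w _.
  transitivity (\int[leb]_u ((k t)%:E * (\1_(`]0%R, L t w[%classic) u)%:E))%E; last first.
    apply: eq_integral => u _; rewrite /f -EFinM !indicE memG t0 mem_setE.
    by rewrite in_itv.
  rewrite ge0_integralZl_EFin//; last first.
    by apply/measurable_EFinP; exact: measurable_indic.
  rewrite integral_indic// setIT; congr (_ * _)%E.
  apply/esym; apply: etrans (lebesgue_measure_itv `]0%R, L t w[) _; rewrite /= lte_fin.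
  have := Lge0 t w (ltW t0); rewrite le_eqVlt => /predU1P[<-|->]; first by rewrite ltxx.
  by rewrite sube0.
transitivity (\int[leb]_t \int[leb]_u \int[P]_w f ((t, u), w))%E.
  apply: eq_integral => t _.
  apply: (@fubini_tonelli _ _ _ _ R P leb (fun z : T * R => f ((t, z.2), z.1))) => //.
  apply: (measurableT_comp mf); apply: measurable_fun_pair; last exact: measurable_fst.
  by apply: measurable_fun_pair => //; exact: measurable_snd.
transitivity (\int[leb]_u \int[leb]_t \int[P]_w f ((t, u), w))%E.
  apply: (@fubini_tonelli _ _ _ _ R leb leb (fun z : R * R => \int[P]_w f (z, w))%E).
    exact: (measurable_fun_fubini_tonelli_F f).
  by move=> z; apply: integral_ge0.
rewrite [RHS]integral_mkcond; apply: eq_integral => u _.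
transitivity (\int[P]_w \int[leb]_t f ((t, u), w))%E.
  apply/esym; apply: (@fubini_tonelli _ _ _ _ R P leb (fun z : T * R => f ((z.2, u), z.1))) => //.
  apply: (measurableT_comp mf); apply: measurable_fun_pair; last exact: measurable_fst.
  by apply: measurable_fun_pair => //; exact: measurable_snd.
rewrite patchE mem_setE in_itv/= andbT.
case: ifPn => [u0|/negbTE u0]; last first.
  rewrite integral0_eq// => w _; rewrite integral0_eq// => t _.
  by rewrite /f indicE memG u0 andbF mulr0.
apply: eq_integral => w _; rewrite -integral_exp_after_inverse ?(ltW u0)//.
rewrite [RHS]integral_mkcond; apply: eq_integral => t _.
rewrite patchE /f indicE memG u0/=.
have -> : (t \in [set t | (0 < t /\ u < L t w)%R]) = (0 < t) && (u < L t w).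
  by apply/idP/andP; rewrite inE.
by case: ifP => _; rewrite ?mulr1 ?mulr0.
Qed.

End inverse.

End local_time.

(** * The exponent of the inverse local time *)

Section levy_exponent.
Context {R : realType}.
Local Notation leb := (@lebesgue_measure R).

(** The extreme values are excluded because the integral would be 0 if
    phi = +oo, and +oo if phi = 0. *)
Lemma integral_expeR_inv (phi : \bar R) (c : R) : 0 < c -> (0 <= phi)%E ->
  (\int[leb]_(u in `]0%R, +oo[) expeR (- (u%:E * phi)) = c%:E)%E ->
  phi = (c^-1)%:E.
Proof.
move=> c0; case: phi => [phi| |] //; last first.
  move=> _ h; exfalso; move: h; rewrite integral0_eq.
    by move=> [] /esym/eqP; rewrite gt_eqF.
  move=> u; rewrite /mkset /= in_itv/= andbT => u0.
  by rewrite gt0_muley ?lte_fin.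
rewrite lee_fin le_eqVlt => /predU1P[<-|phi0].
  under eq_integral do rewrite mule0 oppe0 expeR0.
  by rewrite integral_cst//= lebesgue_measure_itv/= ltry mul1e.
have h := integral_exp_tail 0 phi0.
move: h; under eq_integral do rewrite EFinM.
rewrite ge0_integralZl_EFin//; last 2 first.
- apply: measurable_funTS; apply/measurable_EFinP; apply: measurableT_comp => //.
  by apply: measurableT_comp => //; exact: measurable_funM.
- exact: ltW.
rewrite mulr0 oppr0 expR0.
under [in X in _ -> X -> _]eq_integral do rewrite -EFinM -EFinN/= mulrC.
(* The exponential density with rate phi has mass 1, that is, phi * c = 1. *)
move=> + h; rewrite h -EFinM => -[] pc.
by congr EFin; rewrite -[RHS]mul1r -pc mulfK// gt_eqF.
Qed.

(** 1 / Phi(lambda) is the Laplace transform of t |-> lambda E L_t, which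
    Euler's integral evaluates as
    2^mu mu Gamma(mu) / (Gamma(1 - mu) lambda^mu). *)
Lemma levy_exponent_inverse_local_time (d : measure_display) (T : measurableType d)
    (P : probability T R) (mu : R) (X : R -> {RV P >-> R}) (L : R -> T -> R)
    (n : {measure set (measurableTypeR R) -> \bar R}) (lambda : R) :
  0 < mu < 1 -> bessel_process_from0 P (2 * (1 - mu)) X ->
  bessel_local_time P mu X L -> levy_measure_of P (inverse_local_time L) n ->
  0 < lambda ->
  laplace_exponent n lambda =
    ((2 `^ mu * Gamma mu)^-1 * (lambda `^ mu / mu * Gamma (1 - mu)))%:E.
Proof.
move=> mu01 bX lL [_ _ nE] l0; have [mu0 mu1] := andP mu01.
have G0 : 0 < Gamma mu by apply: Gamma_gt0; rewrite mu0 ltW.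
have G1 : 0 < Gamma (1 - mu) by apply: Gamma_gt0; rewrite subr_gt0 mu1 lerBlDr lerDl ltW.
have [cL aL ndL L0 _] := lL.
have mL t : 0 <= t -> measurable_fun setT (L t) by exact: (adapted_measurable aL).
pose c := lambda * (2 `^ mu / Gamma (1 - mu)) * lambda `^ (- (mu + 1)) * (mu * Gamma mu).
have lhs : (\int[leb]_(t in `]0%R, +oo[)
     ((lambda * expR (- (lambda * t)))%:E * \int[P]_w (L t w)%:E) = c%:E)%E.
  transitivity (\int[leb]_(t in `]0%R, +oo[)
    ((lambda * (2 `^ mu / Gamma (1 - mu)))%:E *
     (t `^ (mu + 1 - 1) * expR (- (lambda * t)))%:E))%E.
    apply: eq_integral => t; rewrite inE /mkset /= in_itv/= andbT => t0.
    rewrite (expectation_local_time mu01 bX lL (ltW t0)).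
    by rewrite addrK -!EFinM; congr EFin; ring.
  rewrite ge0_integralZl_EFin//; last 3 first.
  - by move=> t _; rewrite lee_fin mulr_ge0 ?powR_ge0 ?expR_ge0.
  - by apply: measurable_funTS; apply: measurable_powR_exp.
  - by rewrite !mulr_ge0 ?powR_ge0 ?invr_ge0 ?ltW.
  rewrite integral_powR_exp// gamma_integral_succ// -GammaE ?mu0 ?ltW//.
  by rewrite -!EFinM /c !mulrA.
have rhs : (\int[leb]_(u in `]0%R, +oo[)
    expeR (- (u%:E * laplace_exponent n lambda)) = c%:E)%E.
  rewrite -lhs; apply: etrans _ (esym (laplace_inverse_local_time P cL ndL L0 mL l0)).
  apply: eq_integral => u; rewrite inE /mkset /= in_itv/= andbT => u0.
  by rewrite nE ?(ltW u0)// ?ltW.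
have /= -> := integral_expeR_inv _ _ rhs.
- congr EFin; rewrite /c powRN powRD ?(gt_eqF l0) ?implybT// powRr1 ?ltW//.
  by field; rewrite !gt_eqF// ?powR_gt0.
- by rewrite /c !mulr_gt0 ?powR_gt0 ?invr_gt0.
- apply: integral_ge0 => x; rewrite /mkset /= in_itv/= andbT => x0.
  by rewrite lee_fin; have /andP[] := one_sub_expRM_itv (ltW l0) x0.
Qed.

End levy_exponent.

Theorem corollary5p8 (d : measure_display) (T : measurableType d)
    (R : realType) (P : probability T R) (mu : R)
    (X : R -> {RV P >-> R}) (L : R -> T -> R)
    (n : {measure set (measurableTypeR R) -> \bar R}) :
  0 < mu < 1 ->
  bessel_process_from0 P (2 * (1 - mu)) X ->
  bessel_local_time P mu X L ->
  levy_measure_of P (inverse_local_time L) n ->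
  forall A : set (measurableTypeR R), measurable A ->
    (n A = \int[lebesgue_measure]_(x in A `&` `]0%R, +oo[)
             ((2 `^ mu * Gamma mu)^-1 * (x `^ (1 + mu))^-1)%R%:E)%E.
Proof.
move=> mu01 bX lL nL A mA; have [mu0 mu1] := andP mu01.
have G0 : 0 < Gamma mu by apply: Gamma_gt0; rewrite mu0 ltW.
have [n0 _ _] := nL.
pose S : set R := `]0%R, +oo[%classic.
have mS : measurable (S : set (measurableTypeR R)) by exact: measurable_itv.
pose K := (2 `^ mu * Gamma mu)^-1.
have K0 : 0 <= K by rewrite invr_ge0 mulr_ge0 ?powR_ge0 ?(ltW G0).
pose g (x : R) := K * (x `^ (1 + mu))^-1.
have g0 x : 0 <= g x by apply: mulr_ge0; [exact: K0|rewrite invr_ge0 powR_ge0].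
have mg : measurable_fun setT g.
  apply: measurable_funM => //.
  rewrite (_ : (fun x => _) = (fun x : R => x `^ (- (1 + mu)))).
    exact: measurable_powR.
  by apply/funext => x; rewrite powRN.
pose m : {measure set (measurableTypeR R) -> \bar R} :=
  density_measure (@lebesgue_measure R) mg g0.
have nE c : 0 < c -> laplace_exponent n c =
    (K * (c `^ mu / mu * Gamma (1 - mu)))%:E.
  exact: levy_exponent_inverse_local_time mu01 bX lL nL.
have mE c : 0 < c -> laplace_exponent m c =
    (K * (c `^ mu / mu * Gamma (1 - mu)))%:E.
  move=> c0; rewrite EFinM -integral_one_sub_exp_powR//.
  rewrite -ge0_integralZl_EFin//; last 2 first.
  - move=> x; rewrite /mkset /= in_itv/= andbT => x0.
    have /andP[e0 _] := one_sub_expRM_itv (ltW c0) x0.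
    by rewrite lee_fin mulr_ge0 ?invr_ge0 ?powR_ge0.
  - apply: measurable_funTS; apply/measurable_EFinP; apply: measurable_funM.
      exact: measurable_one_sub_expRM.
    rewrite (_ : (fun x => _) = (fun x : R => x `^ (- (1 + mu)))).
      exact: measurable_powR.
    by apply/funext => x; rewrite powRN.
  pose f := (fun x : R => (1 - expR (- (c * x)))%:E) \_ S.
  have mf : measurable_fun setT f.
    apply: (proj1 (measurable_restrictT _ mS)); apply: measurable_funTS.
    by apply/measurable_EFinP; exact: measurable_one_sub_expRM.
  have f0 x : (0 <= f x)%E.
    apply: erestrict_ge0 => y; rewrite /S /mkset /= in_itv/= andbT => y0.
    by rewrite lee_fin; have /andP[] := one_sub_expRM_itv (ltW c0) y0.
  rewrite /laplace_exponent [LHS]integral_mkcond.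
  transitivity (\int[@lebesgue_measure R]_x (f x * (g x)%:E))%E.
    exact: (@ge0_integral_density _ _ R (@lebesgue_measure R) m g f mg g0 (fun B _ => erefl) mf f0).
  rewrite [RHS]integral_mkcond; apply: eq_integral => x _.
  rewrite /f !patchE; case: ifP => _; last by rewrite mul0e.
  by rewrite -!EFinM; congr EFin; rewrite /g; ring.
have -> : n A = n (A `&` S).
  rewrite (measureDI n mA mS) (@subset_measure0 _ _ _ n _ `]-oo, 0%R]%classic) ?add0e//.
  - exact: measurableD.
  - by move=> x [_]; rewrite /S /mkset /= !in_itv/= andbT => /negP; rewrite -leNgt.
rewrite (@laplace_exponent_unique _ n m _ _ (A `&` S))//.
- by move=> c c0; rewrite nE// ltry.
- by move=> c c0; rewrite nE// mE.
- exact: measurableI.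
Qed.
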